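(* Let $X$ be a compact metric space and let $T:X\rightarrow X$ be an injective continuous mapping. Assume that $\dim(X)=d$, where $d$ is a (finite) nonnegative integer, and that $\dim(P_{n})<\frac{1}{2}n$ for all integers $1\le n\leq 2d$, where $\dim(\cdot)$ is Lebesgue covering dimension and $P_{n}\subset X$ denotes the set of periodic points of $T$ of period $\leq n$. For a continuous function $h:X\to[0,1]$ let $h_{0}^{2d}:X\rightarrow[0,1]^{2d+1}$ be the $(2d+1)$-delay observation map $$h_0^{2d}(x)=\big(h(x),h(Tx),\ldots,h(T^{2d}x)\big).$$ Then the set of functions $h\in C(X,[0,1])$ for which $h_0^{2d}$ is an embedding is comeagre in $C(X,[0,1])$ with respect to the supremum topology.
   Context: $C(X,[0,1])$ is the set of continuous functions $X\to[0,1]$, with the supremum metric $\|f-g\|_{\infty}=\max_{x\in X}|f(x)-g(x)|$, which induces the supremum topology. A subset of a topological space is comeagre (generic) if it is the complement of a countable union of nowhere dense sets. An embedding is a (topological) homeomorphism onto its image. Period: for injective $T:X\to X$, the period of $x\in X$ is the minimal integer $p\geq 1$ with $T^{p}x=x$, and is $\infty$ if no such $p$ exists; $x$ is periodic if its period is finite. Thus $P_n=\{x\in X : T^p x=x \text{ for some integer } 1\le p\le n\}$. Lebesgue covering dimension: for a finite open cover $\alpha$ of a space, its order $\operatorname{ord}(\alpha)$ is $-1+\max_{x}\sum_{U\in\alpha}1_{U}(x)$, equivalently the minimal integer $n$ such that any distinct $U_1,\ldots,U_{n+2}\in\alpha$ satisfy $\bigcap_{i=1}^{n+2}U_i=\emptyset$.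 A cover $\beta$ refines $\alpha$ ($\beta\succ\alpha$) if every $V\in\beta$ is contained in some $U\in\alpha$. Put $D(\alpha)=\min_{\beta\succ\alpha}\operatorname{ord}(\beta)$ over finite open covers $\beta$ refining $\alpha$, and $\dim=\sup_{\alpha}D(\alpha)$ over all finite open covers $\alpha$. In particular $\dim(\emptyset)=-1$. For a subset such as $P_n$, the dimension is that of the subset with its subspace topology. *)

(* Defs.v *)
From HB Require Import structures.
From mathcomp Require Import all_boot all_order all_algebra finmap.
From mathcomp Require Import lra.
From mathcomp Require Import all_classical all_reals all_analysis.

Set Implicit Arguments.
Unset Strict Implicit.
Unset Printing Implicit Defensive.
Import Order.TTheory GRing.Theory Num.Theory.
Import numFieldNormedType.Exports.

Local Open Scope classical_set_scope.
Local Open Scope ring_scope.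

Definition nowhere_dense {Y : topologicalType} (A : set Y) : Prop :=
  (closure A)° = set0.

Definition meagre {Y : topologicalType} (A : set Y) : Prop :=
  exists2 F : (set Y)^nat, (forall i, nowhere_dense (F i)) & A = \bigcup_i F i.

Definition comeagre {Y : topologicalType} (A : set Y) : Prop := meagre (~` A).

Definition homeomorphism {Y Z : topologicalType} (f : Y -> Z) : Prop :=
  continuous f /\
  exists g : Z -> Y, [/\ cancel f g, cancel g f & continuous g].

(* The target [range f] is coerced to the subtype [set_type (range f)], which
   carries the subspace topology. *)
Definition to_range {Y Z : Type} (f : Y -> Z) (y : Y) : range f :=
  SigSub (mem_set (imageT f y)).

Definition embedding {Y Z : topologicalType} (f : Y -> Z) : Prop :=
  homeomorphism (to_range f).

Section covering_dimension.
Context {Y : topologicalType}.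
Implicit Types alpha beta : {fset set Y}.

Definition open_cover alpha : Prop :=
  (forall U : set Y, U \in alpha -> open U) /\
  (forall x : Y, exists2 U : set Y, U \in alpha & U x).

Definition refines beta alpha : Prop :=
  forall V : set Y, V \in beta -> exists2 U : set Y, U \in alpha & V `<=` U.

Definition multiplicity alpha (x : Y) : nat := #|` [fset U in alpha | x \in (U : set Y)]|%fset.

(* The maximum over x is a supremum of natural numbers; adjoining 0 only matters
   when Y is empty, where it makes the order of a cover equal to -1. *)
Definition cover_order (R : realType) alpha : \bar R :=
  (ereal_sup (0 |` [set (multiplicity alpha x)%:R%:E | x in [set: Y]]) - 1)%E.

(* A minimum, as the infimum is over a nonempty set of values in
   {-1, 0, 1, ...}: alpha refines itself. *)
Definition cover_dim (R : realType) alpha : \bar R :=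
  ereal_inf [set cover_order R beta | beta in
    [set beta | open_cover beta /\ refines beta alpha]].

End covering_dimension.

Definition covering_dim (R : realType) (Y : topologicalType) : \bar R :=
  ereal_sup [set cover_dim R alpha | alpha in [set alpha : {fset set Y} |
    open_cover alpha]].

Definition periodic_points {X : Type} (T : X -> X) (n : nat) : set X :=
  [set x | exists p : nat, (1 <= p <= n)%N /\ iter p T x = x].

Definition unit_interval (R : realType) : set R := [set x | 0 <= x <= 1].
Arguments unit_interval : clear implicits.

Definition unit_fun (R : realType) (X : topologicalType) : Type :=
  continuousType X (unit_interval R).

Section supremum_metric.
Context {R : realType} {X : topologicalType}.
Implicit Types f g h : unit_fun R X.

HB.instance Definition _ := Choice.on (unit_fun R X).

(* The set is bounded by 1, so [sup] is a genuine supremum (0 if X is empty); when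
   X is compact and nonempty it is attained. *)
Definition sup_dist f g : R :=
  sup [set `|\val (f x) - \val (g x)| | x in [set: X]].

Let unit_fun_bounds f x : 0 <= \val (f x) <= 1.
Proof. by have := set_valP (f x). Qed.

Let dist_le1 f g x : `|\val (f x) - \val (g x)| <= 1.
Proof.
have /andP[f0 f1] := unit_fun_bounds f x.
have /andP[g0 g1] := unit_fun_bounds g x.
by rewrite ler_distl; apply/andP; split; lra.
Qed.

Let le_sup_dist f g x : `|\val (f x) - \val (g x)| <= sup_dist f g.
Proof.
apply: ub_le_sup; last by exists x.
by exists 1 => _ [y _ <-]; exact: dist_le1.
Qed.

Let sup_dist_le f g e : 0 <= e ->
  (forall x, `|\val (f x) - \val (g x)| <= e) -> sup_dist f g <= e.
Proof.
move=> e0 le_e; rewrite /sup_dist; set D := [set _ | _ in _].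
have [->|/set0P D0] := eqVneq D set0; first by rewrite sup0.
by apply: ge_sup => // _ [x _ <-].
Qed.

Let sup_dist_ge0 f g : 0 <= sup_dist f g.
Proof.
have [[x _]|/forallNP X0] := pselect (exists x : X, True).
  by rewrite (le_trans _ (le_sup_dist f g x)).
rewrite /sup_dist [X in sup X](_ : _ = set0) ?sup0//.
by apply/seteqP; split => // y [x _ _]; case: (X0 x).
Qed.

Let sup_distxx f : sup_dist f f = 0.
Proof.
by apply/eqP; rewrite eq_le sup_dist_ge0 andbT sup_dist_le// => x;
  rewrite subrr normr0.
Qed.

Let sup_dist_positivity f g : sup_dist f g = 0 -> f = g.
Proof.
move=> fg0; apply/continuousEP => x; apply/val_inj/eqP.
by rewrite -subr_eq0 -normr_le0 -fg0 le_sup_dist.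
Qed.

Let sup_dist_sym f g : sup_dist f g = sup_dist g f.
Proof.
by congr sup; apply: eq_imagel => x _; rewrite distrC.
Qed.

Let sup_dist_triangle g f h : sup_dist f h <= sup_dist f g + sup_dist g h.
Proof.
apply: sup_dist_le; first by rewrite addr_ge0.
by move=> x; rewrite (le_trans (ler_distD (\val (g x)) _ _))// lerD.
Qed.

HB.instance Definition _ := @isMetric.Build R (unit_fun R X) sup_dist
  sup_distxx sup_dist_positivity sup_dist_sym sup_dist_triangle.

End supremum_metric.

Definition delay_map (R : realType) (X : topologicalType) (T : X -> X)
    (h : unit_fun R X) (m : nat) (x : X) : 'rV[unit_interval R]_m.+1 :=
  \row_(i < m.+1) h (iter i T x).

(* Main.v *)
From HB Require Import structures.
Require Import Defs.
From mathcomp Require Import all_boot all_order all_algebra finmap.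
From mathcomp Require Import lra zify.
From mathcomp Require Import all_classical all_reals all_analysis.

Set Implicit Arguments.
Unset Strict Implicit.
Unset Printing Implicit Defensive.
Import Order.TTheory GRing.Theory Num.Theory.
Import numFieldNormedType.Exports.

Local Open Scope classical_set_scope.
Local Open Scope ring_scope.

(**
Non-injectivity of the delay map of h means that h(T^i x) = h(T^i y) for all
i <= 2d and some x <> y; on a compact space, an injective delay map is an
embedding. So the functions to be discarded are the union, over a countable
family of sets S of pairs of distinct points, of the functions whose delay map
identifies some pair of S. It remains to choose the sets S so small that each of
these pieces is nowhere dense: when S is compact the piece avoids a ball around
each of its non-elements, so any h must be perturbed, by an arbitrarily small
amount, into a function that separates every pair of S.

Perturbations come from dimension theory. If a closed set K has covers of
multiplicity at most D by sets of small oscillation and the images f_i(K), i < n,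
are pairwise disjoint and f_i is injective on K, then Tietze's theorem yields
functions h' close to h with h'(f_i x) = sum_l phi_l(x) a_l(i) on K, where (phi_l)
is a partition of unity with at most D nonzero terms at each point of K, and where
the vectors a_l are arbitrary up to a small error (prescribe_by_partition). A
coincidence of delay vectors is then a linear relation among few of the vectors
a_l, and vectors in general position (general_position) satisfy none.

Let q be the period of x if it is at most 2d, and 2d + 1 otherwise. Then x lies in
a closed set layer q, equal to P_q or to X, of dimension less than q / 2; thus D
can be taken to be uphalf q, the integer part of (q + 1) / 2. Pairs of distinct
points fall into two classes.

- The orbits never meet (separate_orbits). With q and n attached to x and y and
  n <= q, the relation equates a convex combination of at most uphalf q vectors a_l
  in R^q with a convex combination of at most uphalf n fixed vectors; appending a
  coordinate 1 to record that both have total weight 1, these are at most q + 1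
  vectors of R^(q + 1), and generically they admit no relation involving the a_l.

- The orbits meet (separate_translates). By injectivity one of the points is
  T^k of the other, and k > 0 is taken minimal. Here S is contained in the graph of
  T^k, so that a single partition of unity suffices, and the relation says that a
  convex combination of at most D vectors (a_l(i) - a_l(i + k)), i < D, of R^D
  vanishes. This requires the points T^i x with i < D + k to be distinct, and they
  are: minimality of k forces every period of x to be at least 2k, it is at least q
  as well, and D + k <= max (q, 2k) (minimal_translate_distinct).
*)

(** * General position *)

Section general_position.
Context {R : realType}.

Lemma exists_small_nonroot (p : {poly R}) (e : R) : p != 0 -> 0 < e ->
  exists t, [/\ 0 < t, t <= e & ~~ root p t].
Proof.
move=> p0 e0; apply: contrapT => /forallNP noroot.
pose rs := [seq e / k.+1%:R | k <- iota 0 (size p)].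
have : (size rs < size p)%N.
  apply: max_poly_roots => //.
    apply/allP => _ /mapP[k _ ->]; apply/negP => /negP nr.
    apply: (noroot (e / k.+1%:R)); split => //; first by rewrite divr_gt0.
    by rewrite ler_pdivrMr// ler_pMr// ler1n.
  rewrite map_inj_uniq ?iota_uniq// => i j /(mulfI (lt0r_neq0 e0)) /invr_inj /eqP.
  by rewrite eqr_nat => /eqP [].
by rewrite size_map size_iota ltnn.
Qed.

Lemma common_kernel (m : nat) (vs : seq 'rV[R]_m) : (size vs < m)%N ->
  exists2 lam : 'cV[R]_m, lam != 0 & forall v, v \in vs -> v *m lam = 0.
Proof.
move=> vsm; pose M := \matrix_(i < size vs) nth 0 vs i.
have : cokermx M != 0.
  rewrite -mxrank_eq0 mxrank_coker subn_eq0 -ltnNge.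
  by rewrite (leq_ltn_trans _ vsm)// rank_leq_row.
case/matrix0Pn => i [j Mij].
exists (col j (cokermx M)).
  by apply/matrix0Pn; exists i, ord0; rewrite mxE.
move=> v vvs; have vi : (index v vs < size vs)%N by rewrite index_mem.
have -> : v = row (Ordinal vi) M by rewrite rowK nth_index.
by rewrite colE mulmxA -row_mul mulmx_coker row0 mul0mx.
Qed.

(** Affine functions of the first n coordinates that do not vanish identically.
    Parameters are sequences rather than vectors so that their coordinates can be
    shifted. *)
Definition affine_form (n : nat) (f : (nat -> R) -> R) : Prop :=
  exists (c : R) (w : nat -> R), (c != 0 \/ exists2 i, (i < n)%N & w i != 0) /\
    forall b, f b = c + \sum_(i < n) w i * b i.

(** Along the curve b_i = a_i + t^(i + 1) distinct coordinates have distinct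
    degrees in t, so each form restricts to a nonzero polynomial in t, and finitely
    many polynomials have a common nonroot arbitrarily close to 0. *)
Lemma avoid_affine_forms (K : finType) (P : pred K) (n : nat)
    (f : K -> (nat -> R) -> R) (a : nat -> R) (e : R) :
  (forall k, P k -> affine_form n (f k)) -> 0 < e ->
  exists2 b : nat -> R, (forall i, `|b i - a i| <= e) &
    forall k, P k -> f k b != 0.
Proof.
move=> fP e0.
have /choice[p pP] : forall k, exists p : {poly R}, P k -> p != 0 /\
    forall t, p.[t] = f k (fun i => a i + t ^+ i.+1).
  move=> k; have [Pk|] := boolP (P k); last by exists 0.
  have [c [w [cw fk]]] := fP _ Pk.
  exists ((c + \sum_(i < n) w i * a i)%:P + 'X * \poly_(i < n) w i) => _.
  split=> [|t]; last first.
    rewrite fk; under [in RHS]eq_bigr do rewrite mulrDr.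
    rewrite big_split/= addrA hornerD hornerC hornerM hornerX horner_poly mulr_sumr.
    by congr (_ + _); apply: eq_bigr => i _; rewrite mulrCA exprS.
  apply/negP => /eqP p0.
  have w0 i : (i < n)%N -> w i = 0.
    move=> ilt; have := congr1 (fun q : {poly R} => q`_i.+1) p0.
    by rewrite coefD coefC coefXM coef_poly ilt/= add0r coef0.
  have := congr1 (fun q : {poly R} => q`_0) p0.
  rewrite coefD coefC coefXM eqxx addr0 coef0 big1 => [|i _]; last by rewrite w0 ?mul0r.
  by rewrite addr0; case: cw => [/negPf/eqP//|[i /w0 ->]]; rewrite eqxx.
have [||t [t0 te]] := @exists_small_nonroot (\prod_(k | P k) p k) (Num.min e 1).
- by apply/prodf_neq0 => k /pP [].
- by rewrite lt_min e0 ltr01.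
rewrite rootE horner_prod => /prodf_neq0 tP.
exists (fun i => a i + t ^+ i.+1).
  move=> i; rewrite addrC addKr ger0_norm ?exprn_ge0 ?(ltW t0)//.
  have := te; rewrite le_min => /andP[tle t1].
  by rewrite (le_trans _ tle)// exprS ler_piMr ?exprn_ile1 ?(ltW t0).
move=> k Pk; have := tP k Pk; by have [_ <-] := pP k Pk.
Qed.

(** The vectors G (a l) are chosen one after the other. By the time a new one is
    chosen there are finitely many sets of fewer than m vectors among the C j and the
    vectors already chosen; each is annihilated by some nonzero lam, and the new
    vector is kept off the zero sets of these finitely many lam. In a relation, the
    coefficient of the latest vector must then vanish. Only the coefficients
    of the G (a l) are controlled, since the C j may be dependent. *)
Lemma general_position (I J : finType) (n m : nat) (G : (nat -> R) -> 'rV[R]_m)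
    (C : J -> 'rV[R]_m) (a0 : I -> nat -> R) (e : R) :
  (forall lam : 'cV[R]_m, lam != 0 ->
    affine_form n (fun b => (G b *m lam) ord0 ord0)) ->
  0 < e ->
  exists2 a : I -> nat -> R, (forall l i, `|a l i - a0 l i| <= e) &
    forall (S : {set I}) (T : {set J}) (u : I -> R) (v : J -> R),
      (#|S| + #|T| <= m)%N ->
      \sum_(l in S) u l *: G (a l) = \sum_(j in T) v j *: C j ->
      forall l, l \in S -> u l = 0.
Proof.
move=> GP e0.
suff H (s : seq I) : exists2 a : I -> nat -> R, (forall l i, `|a l i - a0 l i| <= e) &
    forall (S : {set I}) (T : {set J}) (u : I -> R) (v : J -> R),
      {subset S <= s} -> (#|S| + #|T| <= m)%N ->
      \sum_(l in S) u l *: G (a l) = \sum_(j in T) v j *: C j ->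
      forall l, l \in S -> u l = 0.
  have [a aa0 aP] := H (enum I); exists a => // S T u v.
  by apply: aP => l _; rewrite mem_enum.
elim: s => [|x s [a aa0 IH]].
  exists a0 => [l i|S T u v S0 _ _ l /S0]; last by rewrite in_nil.
  by rewrite subrr normr0 ltW.
pose vs (k : {set I} * {set J}) :=
  [seq G (a l) | l <- enum k.1] ++ [seq C j | j <- enum k.2].
pose P (k : {set I} * {set J}) := (size (vs k) < m)%N.
have /choice[lam lamP] : forall k, exists lam : 'cV[R]_m, P k ->
    lam != 0 /\ forall v, v \in vs k -> v *m lam = 0.
  move=> k; have [Pk|] := boolP (P k); last by exists 0.
  by have [l l0 lP] := common_kernel Pk; exists l.
have [||b ba bP] := @avoid_affine_forms _ P n
  (fun k b => (G b *m lam k) ord0 ord0) (a0 x) e => //.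
  by move=> k /lamP[/GP].
exists (fun l => if l == x then b else a l).
  by move=> l i; case: eqP => [->|//].
move=> S T u v Ss cST.
have IH' (S' : {set I}) (T' : {set J}) : x \notin S' -> {subset S' <= x :: s} ->
  (#|S'| + #|T'| <= m)%N ->
  \sum_(l in S') u l *: G (if l == x then b else a l) = \sum_(j in T') v j *: C j ->
  forall l, l \in S' -> u l = 0.
  move=> xS S's cS' E; apply: (IH S' T' u v) => //.
    by move=> l lS; have := S's l lS; rewrite inE => /orP[/eqP lx|//]; rewrite -lx lS in xS.
  rewrite -E; apply: eq_bigr => l lS; case: eqP => // lx.
  by rewrite -lx lS in xS.
have [xS|xS] := boolP (x \in S); last exact: IH'.
move=> E; suff ux : u x = 0.
  move=> l lS; have [->//|lx] := eqVneq l x.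
  apply: (IH' (S :\ x) T); rewrite ?inE ?eqxx ?lx//.
  - by move=> y; rewrite !inE => /andP[_ /Ss]; rewrite inE.
  - by rewrite (leq_trans _ cST)// leq_add2r subset_leq_card// subD1set.
  - rewrite -E (bigD1 x xS)/= ux scale0r add0r; apply: eq_bigl => y.
    by rewrite !inE andbC.
pose k := (S :\ x, T).
have Pk : P k.
  rewrite /P /vs size_cat !size_map -!cardE/= (leq_trans _ cST)//.
  by rewrite [#|S|](cardsD1 x) xS.
have [_ lk] := lamP _ Pk.
have := congr1 (fun M => (M *m lam k) ord0 ord0) E.
rewrite (bigD1 x xS)/= eqxx mulmxDl !mulmx_suml.
rewrite [X in _ + X]big1 ?addr0; last first.
  move=> l /andP[lS lx]; rewrite (negPf lx) -scalemxAl lk ?scaler0//.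
  by rewrite mem_cat map_f// mem_enum !inE lx.
rewrite big1; last first.
  move=> j jT; rewrite -scalemxAl lk ?scaler0//.
  by rewrite mem_cat orbC map_f// mem_enum.
rewrite -scalemxAl !mxE => /eqP; rewrite mulf_eq0 => /orP[/eqP//|].
by have := bP _ Pk; rewrite !mxE => /negPf ->.
Qed.

End general_position.

(** * Covers of small multiplicity *)

Section fine_covers.
Context {R : realType} {X : topologicalType}.

(** The consequence of dim K < D that is used below. Smallness is an arbitrary
    property that is inherited by subsets and holds locally; it will express that
    finitely many functions have small oscillation. The covering sets are open in
    the ambient space, while smallness and multiplicity concern their traces. *)
Definition fine_covers (K : set X) (D : nat) : Prop :=
  forall small : set X -> Prop,
  (forall A B, A `<=` B -> small B -> small A) ->
  (forall x, exists U, [/\ open U, U x & small U]) ->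
  exists (I : finType) (U : I -> set X),
    [/\ forall l, open (U l), forall x, K x -> exists l, U l x,
        forall l, small (U l `&` K) &
        forall x, K x -> (#|[set l | `[< U l x >]]%SET| <= D)%N].

Lemma fine_coversS (K L : set X) (D : nat) :
  K `<=` L -> fine_covers L D -> fine_covers K D.
Proof.
move=> KL fL small smallS smallX.
have [I [U [oU cU sU mU]]] := fL small smallS smallX.
exists I, U; split=> //.
- by move=> x /KL /cU.
- by move=> l; apply: smallS (sU l); exact: setIS.
- by move=> x /KL /mU.
Qed.

Lemma compact_open_cover (Y : topologicalType) (P : set Y -> Prop) :
  compact [set: Y] -> (forall y, exists U, [/\ open U, U y & P U]) ->
  exists alpha : {fset set Y}, open_cover alpha /\ forall U, U \in alpha -> P U.
Proof.
move=> cY UP.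
have [[y0 _]|/forallNP Y0] := pselect (exists y : Y, True); last first.
  exists fset0; split=> [|U]; last by rewrite inE.
  by split=> [U|y]; [rewrite inE|case: (Y0 y)].
pose Y' : ptopologicalType := HB.pack Y (isPointed.Build Y y0).
have : @compact Y' [set: Y'] by exact: cY.
rewrite compact_cover => /(_ (set Y) [set U | open U /\ P U] id)[].
- by move=> U [].
- by move=> y _; have [U [oU Uy PU]] := UP y; exists U.
move=> alpha alphaP covera; exists alpha; split; last first.
  by move=> U /alphaP; rewrite inE => -[].
split=> [U /alphaP|y]; first by rewrite inE => -[].
by have [U Ua Uy] := covera y I; exists U.
Qed.

(** The space Y stands for a subspace of X with inclusion i; allowing any map that
    induces the topology covers both subtypes and X itself. *)
Lemma covering_dim_fine_covers (Y : topologicalType) (i : Y -> X) (D : nat) :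
  compact [set: Y] -> continuous i ->
  (forall V : set Y, open V -> exists2 U : set X, open U & V = i @^-1` U) ->
  (covering_dim R Y < D%:R%:E)%E -> fine_covers (range i) D.
Proof.
move=> cY ci open_ind dimY small smallS smallX.
have [y|alpha [coa sa]] :=
    @compact_open_cover Y (fun V => small (i @` V)) cY _.
  have [U [oU Uy sU]] := smallX (i y).
  exists (i @^-1` U); split=> //; first exact: open_comp.
  by apply: smallS sU => _ [z Uz <-].
have /ereal_inf_lt[_ [beta [cob ba] <-] beta_ltD] :
    (cover_dim R alpha < D%:R%:E)%E.
  by apply: le_lt_trans dimY; apply: ereal_sup_ubound; exists alpha.
have mult y : (multiplicity beta y <= D)%N.
  move: beta_ltD; rewrite /cover_order lteBlDr// => supD.
  have : ((multiplicity beta y)%:R%:E < (D%:R%:E + 1) :> \bar R)%E.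
    by apply: le_lt_trans supD; apply: ereal_sup_ubound; right; exists y.
  by rewrite -EFinD lte_fin natr1 ltr_nat ltnS.
have /choice[U UP] (l : beta) : exists U : set X, open U /\ val l = i @^-1` U.
  by have [U oU VU] := open_ind _ (cob.1 _ (valP l)); exists U.
exists beta, U; split=> [l|_ [y _ <-]|l|_ [y _ <-]].
- by case: (UP l).
- have [V Vb Vy] := cob.2 y; exists [` Vb]%fset.
  have [_ /= /(congr1 (fun W : set Y => W y)) Vl] := UP [` Vb]%fset.
  by change ((i @^-1` U [` Vb]%fset) y); rewrite -Vl.
- have [V Va lV] := ba _ (valP l); apply: smallS (sa _ Va) => z [Uz [y _ zE]].
  subst z; exists y => //; apply: lV.
  by have [_ ->] := UP l.
- apply: leq_trans (mult y); rewrite cardE -(size_map val).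
  apply: uniq_leq_size; first by rewrite map_inj_uniq ?enum_uniq//; exact: val_inj.
  move=> V /mapP[l]; rewrite mem_enum inE => /asboolP Uly ->.
  rewrite !inE (fsvalP l)/=; apply/mem_set.
  by have [_ ->] := UP l.
Qed.

End fine_covers.

(** * Partitions of unity *)

Lemma sum_continuous {R : realType} {T : topologicalType} (I : finType)
    (f : I -> T -> R) :
  (forall l, continuous (f l)) -> continuous (fun x => \sum_l f l x).
Proof.
move=> cf; apply: continuous_big => [|l _]; last exact: cf.
exact: (@add_continuous R^o).
Qed.

Section partition_of_unity.
Context {R : realType} {X : metricType R}.

Lemma inf_mdist_continuous (A : set X) : A !=set0 ->
  continuous (fun x : X => inf [set mdist x z | z in A]).
Proof.
move=> [z0 Az0].
have infB x y : inf [set mdist x z | z in A] - mdist x y <= inf [set mdist y z | z in A].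
  apply: lb_le_inf; first by exists (mdist y z0), z0.
  move=> _ [z Az <-]; rewrite lerBlDl; apply: le_trans (metric_triangle x y z).
  apply: ge_inf; last by exists z.
  by exists 0 => _ [w _ <-]; exact: mdist_ge0.
move=> x; apply/(@cvgrPdist_le _ R^o) => e e0.
apply/metricType_numDomainType.nbhs_mdistP; exists e => //= y xy.
rewrite ler_distlC; apply/andP; split.
  by apply: le_trans (infB x y); rewrite lerB// ltW.
by rewrite -lerBlDr; apply: le_trans (infB y x); rewrite lerB// metric_sym ltW.
Qed.

Lemma open_support (U : set X) : open U -> exists f : X -> R,
  [/\ continuous f, forall x, 0 <= f x & forall x, (f x != 0) <-> U x].
Proof.
move=> oU; have [U0|/set0P U0] := eqVneq (~` U) set0.
  exists (fun=> 1); split=> // [x|x]; first exact: cvg_cst.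
  rewrite oner_neq0; split=> // _; apply: contrapT => nU.
  by have : (~` U) x by []; rewrite U0.
have ge0 x : 0 <= inf [set mdist x z | z in ~` U].
  have [z Uz] := U0; apply: lb_le_inf; first by exists (mdist x z), z.
  by move=> _ [w _ <-]; exact: mdist_ge0.
exists (fun x => inf [set mdist x z | z in ~` U]); split=> // x.
  exact: inf_mdist_continuous.
split=> [|Ux].
  apply: contraPP => nU; apply/negP; rewrite negbK eq_le ge0 andbT.
  apply: ge_inf; first by exists 0 => _ [w _ <-]; exact: mdist_ge0.
  by exists x; rewrite ?mdistxx.
have : nbhs x U by exact: open_nbhs_nbhs.
rewrite -metricType_numDomainType.filter_from_mdist_nbhs => -[e /= e0 eU].
rewrite gt_eqF// (lt_le_trans e0)//; apply: lb_le_inf.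
  by have [z Uz] := U0; exists (mdist x z), z.
move=> _ [w Uw <-]; rewrite leNgt; apply/negP => /eU; exact: Uw.
Qed.


Lemma partition_of_unity (I : finType) (U : I -> set X) (K : set X) :
  closed K -> (forall l, open (U l)) -> (forall x, K x -> exists l, U l x) ->
  exists phi : I -> X -> R,
    [/\ forall l, continuous (phi l), forall l x, 0 <= phi l x,
        forall l x, phi l x != 0 -> U l x &
        forall x, K x -> \sum_l phi l x = 1].
Proof.
move=> clK oU cU.
have /choice[th thP] := fun l => open_support (oU l).
have [th0 [cth0 th0_ge0 th0P]] := open_support (closed_openC clK).
(* The complement of K takes part in the cover so that the total weight S is
   positive on the whole space; its weight vanishes on K. *)
pose S x := th0 x + \sum_l th l x.
have sge0 x : 0 <= \sum_l th l x by apply: sumr_ge0 => l _; have [_] := thP l.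
have S0 x : S x != 0.
  rewrite gt_eqF//; have [Kx|nKx] := pselect (K x); last first.
    by rewrite ltr_wpDr// lt_def th0_ge0 andbT; apply/th0P.
  rewrite ltr_wpDl//; have [l Ulx] := cU x Kx; rewrite (bigD1 l)//= ltr_wpDr//.
    by apply: sumr_ge0 => k _; have [_] := thP k.
  by have [_ + /(_ x)[_ /(_ Ulx)]] := thP l; rewrite lt_def => -> ->.
have cS : continuous S.
  move=> x; apply: cvgD; first exact: cth0.
  by apply: sum_continuous => l; have [] := thP l.
exists (fun l x => th l x / S x); split.
- move=> l x; apply: cvgM; first by have [+ _ _] := thP l; apply.
  by apply: cvgV; [exact: S0|exact: cS].
- move=> l x; rewrite divr_ge0 ?addr_ge0//.
  by have [_] := thP l.
- move=> l x; rewrite mulf_eq0 negb_or => /andP[+ _].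
  by have [_ _ /(_ x)[]] := thP l.
- move=> x Kx; have th0x : th0 x = 0 by apply: contrapT => /eqP/th0P; apply.
  by have := S0 x; rewrite -mulr_suml /S th0x add0r => /divff.
Qed.

End partition_of_unity.

(** The restriction of f to K is a closed map, hence a quotient map onto its
    image. *)
Lemma continuous_on_image {Y Z W : topologicalType} (K : set Y) (f : Y -> Z)
    (h : Y -> W) (g : Z -> W) :
  hausdorff_space Z -> compact K -> continuous f -> continuous h ->
  (forall x, K x -> g (f x) = h x) -> {within f @` K, continuous g}.
Proof.
move=> hZ cK cf ch gfh; apply/continuous_closedP => B cB.
apply/closed_subspaceP; exists (f @` (K `&` h @^-1` B)).
  apply: compact_closed => //; apply: continuous_compact.
    exact: continuous_subspaceT.
  by apply: compact_closedI => //; exact: closed_comp.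
apply/seteqP; split=> z [].
  by move=> [x [Kx Bx] <-] _; split; [rewrite /= /from_subspace gfh|exists x].
move=> Bz [x Kx xz]; split; exists x => //; split=> //=.
by move: Bz; rewrite -xz /= /from_subspace gfh.
Qed.

(** * Prescribing values along disjoint images *)

Section prescribing.
Context {R : realType} {X : metricType R} (compactX : compact [set: X]).
Variables (f : nat -> X -> X) (cf : forall i, continuous (f i)).

Definition jointly_injective (n : nat) (K : set X) : Prop :=
  forall i j x y, (i < n)%N -> (j < n)%N -> K x -> K y ->
    f i x = f j y -> i = j /\ x = y.

(** The required correction d = g_i - h o f_i is transported to the compact set
    formed by the images f_i(K), set to 0 on F, and extended by Tietze's theorem with
    the same bound e. *)
Lemma prescribe_on_images (n : nat) (K F : set X) (h : X -> R)
    (g : nat -> X -> R) (e : R) :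
  closed K -> closed F -> jointly_injective n K ->
  (forall i x, (i < n)%N -> K x -> ~ F (f i x)) ->
  continuous h -> (forall i, continuous (g i)) -> 0 < e ->
  (forall i x, (i < n)%N -> K x -> `|g i x - h (f i x)| <= e) ->
  exists h' : X -> R, [/\ continuous h', forall x, `|h' x - h x| <= e,
    forall i x, (i < n)%N -> K x -> h' (f i x) = g i x &
    forall x, F x -> h' x = h x].
Proof.
move=> clK clF inj disj ch cg e0 gh.
have cK : compact K by apply: subclosed_compact compactX _.
pose P z (p : nat * X) := [/\ (p.1 < n)%N, K p.2 & f p.1 p.2 = z].
pose d z : R := if pselect (exists p, P z p) is left ex then
  let p := projT1 (cid ex) in g p.1 p.2 - h z else 0.
have dE i x : (i < n)%N -> K x -> d (f i x) = g i x - h (f i x).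
  move=> iltn Kx; rewrite /d; case: pselect => [ex|]; last by case; exists (i, x).
  case: cid => -[j y] /= [jn Ky /= jyE].
  by have [/= ? ?] := inj _ _ _ _ jn iltn Ky Kx jyE; subst j y.
have dF z : F z -> d z = 0.
  move=> Fz; rewrite /d; case: pselect => // ex; exfalso.
  by have [[i x] [/= iltn Kx xz]] := ex; apply: (disj i x iltn Kx); rewrite xz.
pose C := \bigcup_(i in `I_n) f i @` K.
have clI i : closed (f i @` K).
  apply: compact_closed; first exact: metric_hausdorff.
  by apply: continuous_compact => //; exact: continuous_subspaceT.
have clC : closed C by rewrite /C; apply: closed_bigcup.
have cdC : {within C, continuous d}.
  rewrite /C bigcup_mkord.
  have : forall i, (i < n)%N -> {within f i @` K, continuous d}.
    move=> i iltn; apply: (@continuous_on_image _ _ _ K (f i)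
      (fun x => g i x - h (f i x))) => //.
    - exact: metric_hausdorff.
    - move=> x; apply: cvgB; first exact: cg.
      by apply: continuous_comp; [exact: cf|exact: ch].
    - by move=> x; exact: dE.
  move=> cd; suff H m : (m <= n)%N ->
    {within \big[setU/set0]_(i < m) (f i @` K), continuous d} by exact: H.
  elim: m => [_|m IH mn]; first by rewrite big_ord0; exact: continuous_subspace0.
  rewrite big_ord_recr/=; apply: withinU_continuous => //.
  - by rewrite -(bigcup_mkord m (fun i => f i @` K)); exact: closed_bigcup.
  - exact/IH/ltnW.
  - exact: cd.
have cdF : {within F, continuous d}.
  apply: (@subspace_eq_continuous _ F _ (fun=> 0)).
    by move=> z /set_mem /dF.
  by move=> z; exact: cvg_cst.
have := @continuous_bounded_extension X R pseudometric_normal (C `|` F) _ d e e0.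
move=> [||z|d' [dd' cd' d'e]].
- exact: closedU.
- exact: withinU_continuous.
- by move=> [[i iltn [x Kx <-]]|/dF ->]; [rewrite dE// gh|rewrite normr0 ltW].
exists (fun x => h x + d' x); split.
- by move=> x; apply: cvgD; [exact: ch|exact: cd'].
- by move=> x; rewrite addrC addKr.
- move=> i x iltn Kx; rewrite -dd'; first by rewrite dE// addrC subrK.
  by rewrite inE; left; exists i => //; exists x.
- by move=> x Fx; rewrite -dd' ?dF ?addr0// inE; right.
Qed.

(** The centre a0 consists of sampled values of h: a0 l i is the value of h o f_i at
    a point of the l-th covering set. Small oscillation makes the corresponding
    combination of the phi_l close to h o f_i on K, and moving the coefficients by e
    moves a convex combination by at most e. The closed set F protects values
    prescribed earlier. *)
Lemma prescribe_by_partition (n D : nat) (K F : set X) (h : X -> R) (e : R) :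
  closed K -> fine_covers K D -> closed F -> jointly_injective n K ->
  (forall i x, (i < n)%N -> K x -> ~ F (f i x)) -> continuous h -> 0 < e ->
  exists (I : finType) (phi : I -> X -> R) (a0 : I -> nat -> R),
    [/\ forall x, K x -> \sum_l phi l x = 1,
      forall x, K x -> (#|[set l | phi l x != 0%R]%SET| <= D)%N &
      forall a : I -> nat -> R, (forall l i, `|a l i - a0 l i| <= e) ->
      exists h' : X -> R, [/\ continuous h', forall x, `|h' x - h x| <= e *+ 2,
        forall i x, (i < n)%N -> K x -> h' (f i x) = \sum_l phi l x * a l i &
        forall x, F x -> h' x = h x]].
Proof.
move=> clK fK clF inj disj ch e0.
pose small A := forall x y, A x -> A y ->
  forall i, (i < n)%N -> `|h (f i x) - h (f i y)| <= e.
have [A B AB sB x y /AB Bx /AB By|x|I [U [oU cU sU mU]]] := fK small.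
- exact: sB.
- pose V := \bigcap_(i in `I_n) [set y | `|h (f i x) - h (f i y)| < e / 2].
  exists (V°); split.
  + exact: open_interior.
  + have : \forall y \near x, forall i : 'I_n, `|h (f i x) - h (f i y)| < e / 2.
      apply: filter_forall => i; have : {for x, continuous (h \o f i)}.
        by apply: continuous_comp; [exact: cf|exact: ch].
      by move=> /(@cvgrPdist_lt _ R^o) /(_ (e / 2)); apply; rewrite divr_gt0.
    by apply: filterS => y yV i /= ilt; have := yV (Ordinal ilt).
  + move=> y z /interior_subset yV /interior_subset zV i iltn.
    have := yV i iltn; have := zV i iltn; rewrite /= => zi yi.
    rewrite (le_trans (ler_distD (h (f i x)) _ _))// [e in _ <= e]splitr.
    by rewrite lerD// ltW// distrC.
have [phi [cphi phi0 phiU phi1]] := partition_of_unity clK oU cU.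
have /choice[a0 a0P] : forall l, exists b : nat -> R, forall i x, (i < n)%N ->
    K x -> U l x -> `|b i - h (f i x)| <= e.
  move=> l; have [[y [Uy Ky]]|Ul0] := pselect (U l `&` K !=set0); last first.
    by exists (fun=> 0) => i x _ Kx Ux; case: Ul0; exists x.
  by exists (fun i => h (f i y)) => i x iltn Kx Ux; apply: (sU l).
exists I, phi, a0; split => //.
  move=> x Kx; apply: leq_trans (mU x Kx); apply: subset_leq_card.
  by apply/fintype.subsetP => l; rewrite !inE => /phiU.
move=> a aa0; apply: prescribe_on_images => //.
- move=> i; apply: sum_continuous => l x; apply: cvgM; first exact: cphi.
  exact: cvg_cst.
- by rewrite mulrn_wgt0.
- move=> i x iltn Kx.
  rewrite -[h (f i x)]mul1r -(phi1 x Kx) mulr_suml -sumrB.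
  rewrite (le_trans (ler_norm_sum _ _ _))//.
  rewrite -[leRHS]mul1r -(phi1 x Kx) mulr_suml; apply: ler_sum => l _.
  rewrite -mulrBr normrM ger0_norm//.
  have [->|/phiU Ux] := eqVneq (phi l x) 0; first by rewrite !mul0r.
  rewrite ler_wpM2l// (le_trans (ler_distD (a0 l i) _ _))// mulr2n.
  by rewrite lerD// a0P.
Qed.

End prescribing.

(** * Separating pairs of points by perturbation *)

Lemma affine_form_homogenize {R : realType} (q : nat) (lam : 'cV[R]_q.+1) :
  lam != 0 -> affine_form q (fun b =>
    ((\row_(i < q.+1) (if (i < q)%N then b i else 1)) *m lam) ord0 ord0).
Proof.
move=> /matrix0Pn[i [j]]; rewrite ord1 => lam_i.
exists (lam ord_max ord0), (fun i => lam (inord i) ord0); split; last first.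
  move=> b; rewrite mxE big_ord_recr/= !mxE/= ltnn mul1r addrC; congr (_ + _).
  apply: eq_bigr => k _; rewrite mxE /= ltn_ord mulrC; congr (lam _ _ * _).
  by apply: val_inj; rewrite /= inordK// ltnW// ltnS.
have [iq|iq] := ltnP i q; last first.
  left; rewrite (_ : ord_max = i)//; apply: val_inj => /=; apply/eqP.
  by rewrite eqn_leq iq -ltnS ltn_ord.
by right; exists i => //; rewrite inord_val.
Qed.

(** If p is the last index with lam p nonzero, then b_(p + k) occurs in the
    resulting form with coefficient - lam p: this is where k > 0 matters. *)
Lemma affine_form_difference {R : realType} (D k : nat) (lam : 'cV[R]_D) :
  (0 < k)%N -> lam != 0 -> affine_form (D + k) (fun b =>
    ((\row_(i < D) (b i - b (i + k)%N)) *m lam) ord0 ord0).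
Proof.
move=> k0 lam0.
(* lam extended by 0 beyond its last index *)
pose w (i : nat) : R := if insub i is Some j then lam j ord0 else 0.
have wE (i : 'I_D) : w i = lam i ord0 by rewrite /w valK.
have w0 i : (D <= i)%N -> w i = 0.
  by move=> Di; rewrite /w insubF// ltnNge Di.
exists 0, (fun i => w i - (if (i < k)%N then 0 else w (i - k)%N)); split; last first.
  move=> b; rewrite add0r mxE; under eq_bigr do rewrite mxE mulrBl -wE.
  under [in RHS]eq_bigr do rewrite mulrBl.
  rewrite !sumrB; congr (_ - _).
    rewrite big_split_ord/= [X in _ = _ + X]big1 ?addr0//.
      by apply: eq_bigr => i _; rewrite mulrC.
    by move=> i _; rewrite w0 ?mul0r// leq_addr.
  rewrite -(big_mkord xpredT (fun i => (if (i < k)%N then 0 else w (i - k)%N) * b i)).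
  rewrite (@big_cat_nat _ _ _ k)//= ?leq_addl//.
  rewrite [X in X + _]big_nat_cond [X in X + _]big1 ?add0r; last first.
    by move=> i /andP[/andP[_ ->] _]; rewrite mul0r.
  rewrite -[X in \sum_(X <= i < _) _]add0n big_addn addnK big_mkord; apply: eq_bigr => i _.
  by rewrite ltnNge leq_addl/= addnK mulrC.
right; have [i [j]] := matrix0Pn _ lam0; rewrite ord1 => lam_i.
have ex : exists i, w i != 0 by exists i; rewrite wE.
have ub p : w p != 0 -> (p <= D)%N.
  by apply: contraR; rewrite -ltnNge => /ltnW /w0 ->.
case: (ex_maxnP ex ub) => p wp pmax; exists (p + k)%N.
  by rewrite ltn_add2r ltnNge; apply: contraNN wp => /w0 ->.
rewrite ltnNge leq_addl/= addnK.
rewrite [w (p + k)%N](_ : _ = 0) ?sub0r ?oppr_eq0//.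
apply/eqP; apply: contraT => /pmax; lia.
Qed.

Section separation.
Context {R : realType} {X : metricType R} (compactX : compact [set: X]).
Variables (f : nat -> X -> X) (cf : forall i, continuous (f i)).

(** On L the function is only made into combinations of some fixed vectors c; by
    periodicity the values along q steps are those along m steps, repeated. The
    perturbation on K, which leaves h1 unchanged on the images of L, then chooses
    the vectors a in general position with respect to these. The
    count is uphalf q + uphalf m <= q + 1, and a vanishing relation contradicts the
    fact that the weights phi add up to 1. *)
Lemma separate_orbits (q m : nat) (K L : set X) (h : X -> R) (e : R) :
  (0 < m)%N -> (m <= q)%N -> closed K -> closed L ->
  fine_covers K (uphalf q) -> fine_covers L (uphalf m) ->
  jointly_injective f q K -> jointly_injective f m L ->
  (forall i j x y, (i < q)%N -> (j < m)%N -> K x -> L y -> f i x <> f j y) ->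
  (forall i y, (i < q)%N -> L y -> f i y = f (i %% m)%N y) ->
  continuous h -> 0 < e ->
  exists h' : X -> R, [/\ continuous h', forall x, `|h' x - h x| <= e &
    forall x y, K x -> L y -> exists2 i, (i < q)%N & h' (f i x) <> h' (f i y)].
Proof.
move=> m0 mq clK clL fK fL injK injL KL perL ch e0.
have e40 : 0 < e / 4 by rewrite divr_gt0.
have [J [psi [c [psi1 psiD Hc]]]] :=
  @prescribe_by_partition R X compactX f cf m _ L set0 h _
    clL fL closed0 injL (fun _ _ _ _ => id) ch e40.
have [|h1 [ch1 h1h h1E _]] := Hc c.
  by move=> l i; rewrite subrr normr0 ltW.
pose F := \bigcup_(j in `I_m) f j @` L.
have clF : closed F.
  apply: closed_bigcup => // j _; apply: compact_closed.
    exact: metric_hausdorff.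
  apply: continuous_compact; first exact/continuous_subspaceT/cf.
  exact: subclosed_compact compactX _.
have KF i x : (i < q)%N -> K x -> ~ F (f i x).
  by move=> iq Kx [j jm [y Ly yx]]; exact: (KL i j x y).
have [I [phi [a0 [phi1 phiD H]]]] :=
  @prescribe_by_partition R X compactX f cf q _ K F h1 _
    clK fK clF injK KF ch1 e40.
pose G (b : nat -> R) := \row_(i < q.+1) (if (i < q)%N then b i else 1).
pose C j := G (fun i => c j (i %% m)%N).
have [a aa0 aP] := @general_position R I J q q.+1 G C a0 _
  (@affine_form_homogenize R q) e40.
have [h2 [ch2 h2h1 h2E h2F]] := H a aa0.
exists h2; split=> // [x|x y Kx Ly].
  rewrite (le_trans (ler_distD (h1 x) _ _))//.
  rewrite (le_trans (lerD (h2h1 x) (h1h x)))// !mulr2n; lra.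
apply: contrapT => noi.
have Eq i : (i < q)%N -> h2 (f i x) = h2 (f i y).
  by move=> iq; apply: contrapT => ne; apply: noi; exists i.
pose S := [set l | phi l x != 0]%SET.
pose S' := [set j | psi j y != 0]%SET.
have phiS : forall l, l \in S -> phi l x = 0.
  apply: (aP S S' (phi^~ x) (psi^~ y)).
    have := phiD x Kx; have := psiD y Ly; rewrite -/S -/S'; lia.
  have restr (I' : finType) (u : I' -> R) (g : I' -> 'rV[R]_q.+1) :
      \sum_(l in [set l | u l != 0]%SET) u l *: g l = \sum_l u l *: g l.
    rewrite big_mkcond/=; apply: eq_bigr => l _; rewrite inE.
    by case: eqP => [->|]; rewrite ?scale0r.
  rewrite !restr; apply/rowP => i; rewrite !summxE.
  under eq_bigr do rewrite !mxE; under [RHS]eq_bigr do rewrite !mxE.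
  have [iq|iq] := ltnP i q; last first.
    by under eq_bigr do rewrite mulr1; under [RHS]eq_bigr do rewrite mulr1;
      rewrite phi1 ?psi1.
  rewrite -h2E// -h1E ?ltn_mod// -perL// Eq// perL// h2F//.
  by exists (i %% m)%N; [rewrite /= ltn_mod|exists y].
suff : \sum_l phi l x = 0 by rewrite phi1// => /eqP; rewrite oner_eq0.
apply: big1 => l _; have [//|l0] := eqVneq (phi l x) 0.
by apply: phiS; rewrite inE.
Qed.

(** Only the points f_i x with i < D + k enter, and their values are independent
    parameters, so the difference vectors are in general position. *)
Lemma separate_translates (D k : nat) (K : set X) (h : X -> R) (e : R) :
  (0 < k)%N -> closed K -> fine_covers K D -> jointly_injective f (D + k) K ->
  continuous h -> 0 < e ->
  exists h' : X -> R, [/\ continuous h', forall x, `|h' x - h x| <= e &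
    forall x, K x -> exists2 i, (i < D)%N & h' (f i x) <> h' (f (i + k)%N x)].
Proof.
move=> k0 clK fK injK ch e0.
have e20 : 0 < e / 2 by rewrite divr_gt0.
have [I [phi [a0 [phi1 phiD H]]]] :=
  @prescribe_by_partition R X compactX f cf _ _ K set0 h _
    clK fK closed0 injK (fun _ _ _ _ => id) ch e20.
pose G (b : nat -> R) := \row_(i < D) (b i - b (i + k)%N).
have [a aa0 aP] := @general_position R I void (D + k) D G (fun=> 0) a0 _
  (fun lam => affine_form_difference k0) e20.
have [h' [ch' h'h h'E _]] := H a aa0.
exists h'; split=> // [x|x Kx].
  by rewrite (le_trans (h'h x))// mulr2n -splitr.
apply: contrapT => noi.
have Eq i : (i < D)%N -> h' (f i x) = h' (f (i + k)%N x).
  by move=> iq; apply: contrapT => ne; apply: noi; exists i.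
pose S := [set l | phi l x != 0]%SET.
have phiS : forall l, l \in S -> phi l x = 0.
  apply: (aP S finset.set0 (phi^~ x) (fun=> 0)).
    by rewrite cards0 addn0 phiD.
  rewrite big_set0; apply/rowP => i; rewrite summxE mxE.
  rewrite -[RHS](subrr (h' (f i x))) {2}Eq// !h'E ?ltn_add2r//; last first.
    by rewrite (leq_trans (ltn_ord i)) ?leq_addr.
  rewrite -sumrB big_mkcond/=; apply: eq_bigr => l _; rewrite inE !mxE -mulrBr.
  by case: eqP => [->|]; rewrite ?mul0r.
suff : \sum_l phi l x = 0 by rewrite phi1// => /eqP; rewrite oner_eq0.
apply: big1 => l _; have [//|l0] := eqVneq (phi l x) 0.
by apply: phiS; rewrite inE.
Qed.

End separation.

(** * Nowhere dense sets of observables *)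

Section nowhere_dense_meagre.

Lemma nowhere_denseS {Y : topologicalType} (A B : set Y) :
  A `<=` B -> nowhere_dense B -> nowhere_dense A.
Proof.
by move=> AB B0; rewrite /nowhere_dense -subset0 -B0; exact/interiorS/closureS.
Qed.

Lemma nowhere_dense0 {Y : topologicalType} : nowhere_dense (@set0 Y).
Proof. by rewrite /nowhere_dense closure0 interior0. Qed.

Lemma nowhere_dense_avoiding_ball {R : realType} {Y : metricType R} (A : set Y) :
  (forall h e, 0 < e -> exists2 h', mdist h h' < e &
    exists2 r, 0 < r & forall g, mdist h' g < r -> ~ A g) ->
  nowhere_dense A.
Proof.
move=> H; rewrite /nowhere_dense -subset0 => h.
rewrite /interior -metricType_numDomainType.filter_from_mdist_nbhs.
move=> -[e /= e0 eA]; have [h' hh' [r r0 rA]] := H h e e0.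
have /(_ (ball h' r))[|g [Ag]] := eA h' hh'; first exact: nbhsx_ballx.
by rewrite ballEmdist => /rA.
Qed.

Lemma meagre_countable {Y : topologicalType} (I : countType) (A : set Y)
    (F : I -> set Y) :
  (forall i, nowhere_dense (F i)) -> A `<=` \bigcup_i F i -> meagre A.
Proof.
move=> nF AF.
exists (fun k => A `&` (if choice.unpickle k is Some i then F i else set0)).
  move=> k; apply: (@nowhere_denseS _ _ _ (@subIsetr _ _ _)).
  by case: choice.unpickle => [i|]; [exact: nF|exact: nowhere_dense0].
apply/seteqP; split=> [h Ah|h [k _ []]//].
by have [i _ Fi] := AF h Ah; exists (choice.pickle i) => //; rewrite choice.pickleK.
Qed.

End nowhere_dense_meagre.

Section unit_functions.
Context {R : realType} {X : topologicalType}.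

Lemma unit_fun_itv (h : unit_fun R X) x : 0 <= \val (h x) <= 1.
Proof. exact: (set_valP (h x)). Qed.

Lemma val_unit_fun_continuous (h : unit_fun R X) :
  continuous (fun x => \val (h x) : R).
Proof.
move=> x; apply: (@continuous_comp _ _ _ h (\val : unit_interval R -> R)).
  exact: (@cts_fun _ _ h).
exact: initial_continuous.
Qed.

Lemma unit_fun_of (f : X -> R) : continuous f -> (forall x, 0 <= f x <= 1) ->
  exists h : unit_fun R X, forall x, \val (h x) = f x.
Proof.
move=> cf f01.
pose g (x : X) : unit_interval R := SigSub (mem_set (f01 x) : f x \in unit_interval R).
have cg : continuous g by apply: continuous_comp_initial; exact: cf.
by exists (mkcts cg).
Qed.

Lemma val_unit_fun_dist (f g : unit_fun R X) x :
  `|\val (f x) - \val (g x)| <= mdist f g.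
Proof.
apply: ub_le_sup; last by exists x.
exists 1 => _ [y _ <-]; rewrite ler_distl.
have /andP[? ?] := unit_fun_itv f y; have /andP[? ?] := unit_fun_itv g y.
by apply/andP; split; lra.
Qed.

Lemma mdist_unit_fun_le (f g : unit_fun R X) e : 0 <= e ->
  (forall x, `|\val (f x) - \val (g x)| <= e) -> mdist f g <= e.
Proof.
move=> e0 le_e.
change (sup [set `|\val (f x) - \val (g x)| | x in [set: X]] <= e).
set D := [set _ | _ in _].
have [->|/set0P D0] := eqVneq D set0; first by rewrite sup0.
by apply: ge_sup => // _ [x _ <-].
Qed.

End unit_functions.

Section delay_coincidences.
Context {R : realType} {X : metricType R} (compactX : compact [set: X]).
Variables (T : X -> X) (contT : continuous T) (m : nat).

Definition delay_eq (h : unit_fun R X) (x y : X) : Prop :=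
  forall i, (i <= m)%N -> h (iter i T x) = h (iter i T y).

Definition coincide_on (S : set (X * X)) : set (unit_fun R X) :=
  [set h | exists2 z, S z & delay_eq h z.1 z.2].

Lemma coincide_onS S S' : S `<=` S' -> coincide_on S `<=` coincide_on S'.
Proof. by move=> SS' h [z /SS' Sz hz]; exists z. Qed.

Lemma iter_continuous i : continuous (iter i T).
Proof.
elim: i => [|i IH] x; first exact: cvg_id.
by apply: (@continuous_comp _ _ _ (iter i T) T); [exact: IH|exact: contT].
Qed.

(** Real-valued perturbations suffice: h is first contracted into [d, 1 - d], after
    which an error of d cannot leave the unit interval. The separating function keeps
    separating S under a further small change because, S being compact, the total
    gap between the two delay vectors is bounded below on S. *)
Lemma coincide_on_nowhere_dense (S : set (X * X)) : compact S ->
  (forall (h : X -> R) e, continuous h -> 0 < e ->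
    exists h' : X -> R, [/\ continuous h', forall x, `|h' x - h x| <= e &
      forall z, S z -> exists2 i, (i <= m)%N &
        h' (iter i T z.1) <> h' (iter i T z.2)]) ->
  nowhere_dense (coincide_on S).
Proof.
move=> cS H; apply: nowhere_dense_avoiding_ball => h e e0.
pose d := Num.min (e / 4) (1 / 2).
have d0 : 0 < d by rewrite lt_min !divr_gt0.
have d2 : d <= 1 / 2 by rewrite /d ge_min lexx orbT.
have d4 : d <= e / 4 by rewrite /d ge_min lexx.
pose h0 x : R := d + (1 - 2 * d) * \val (h x).
have ch0 : continuous h0.
  move=> x; apply: cvgD; first exact: cvg_cst.
  by apply: cvgM; [exact: cvg_cst|exact: val_unit_fun_continuous].
have [h1 [ch1 h1h0 h1S]] := H h0 d ch0 d0.
have h0h x : [/\ `|h0 x - \val (h x)| <= d, d <= h0 x & h0 x <= 1 - d].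
  have /andP[? ?] := unit_fun_itv h x.
  by rewrite /h0 ler_distl; split; [apply/andP; split| |]; nra.
have [|h' h'E] := unit_fun_of ch1.
  move=> x; have [_ ? ?] := h0h x.
  by have := h1h0 x; rewrite ler_distl => /andP[? ?]; apply/andP; split; lra.
exists h'.
  apply: (@le_lt_trans _ _ (d + d)); last lra.
  apply: mdist_unit_fun_le => [|x]; first by rewrite addr_ge0 ?ltW.
  rewrite h'E distrC (le_trans (ler_distD (h0 x) _ _))// lerD//.
  by have [] := h0h x.
have [->|/set0P S0] := eqVneq S set0; first by exists 1 => // g _ [].
pose gap (z : X * X) := \sum_(i < m.+1) `|h1 (iter i T z.1) - h1 (iter i T z.2)|.
have cgap : continuous gap.
  apply: sum_continuous => i z.
  apply: (@cvg_norm _ R^o); apply: (@cvgB _ R^o).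
    apply: (@continuous_comp _ _ _ (fun z : X * X => z.1) (h1 \o iter i T)).
      exact: cvg_fst.
    by apply: continuous_comp; [exact: iter_continuous|exact: ch1].
  apply: (@continuous_comp _ _ _ (fun z : X * X => z.2) (h1 \o iter i T)).
    exact: cvg_snd.
  by apply: continuous_comp; [exact: iter_continuous|exact: ch1].
have [c /set_mem Sc cmin] :=
  compact_EVT_min S0 cS (continuous_subspaceT cgap).
have gap0 : 0 < gap c.
  have [i im ic] := h1S c Sc.
  rewrite /gap (bigD1 (Ordinal (im : (i < m.+1)%N)))//= ltr_wpDr ?sumr_ge0//.
  by rewrite normr_gt0 subr_eq0; exact/eqP.
exists (gap c / (2 * m.+1%:R) / 2); first by rewrite !divr_gt0// mulr_gt0.
move=> g hg [z Sz zeq]; have := cmin z (mem_set Sz); apply/negP; rewrite -ltNge.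
apply: (@le_lt_trans _ _ (\sum_(i < m.+1) (gap c / (2 * m.+1%:R)))); last first.
  rewrite sumr_const card_ord -[_ *+ m.+1]mulr_natr.
  have -> : gap c / (2 * m.+1%:R) * m.+1%:R = gap c / 2.
    by rewrite invfM mulrA mulfVK// pnatr_eq0.
  by rewrite ltr_pdivrMr// ltr_pMr// ltr1n.
apply: ler_sum => i _; rewrite (le_trans (ler_distD (\val (g (iter i T z.1))) _ _))//.
rewrite [leRHS]splitr lerD//.
  by rewrite -h'E (le_trans (val_unit_fun_dist _ _ _))// ltW.
rewrite (zeq i); last by rewrite -ltnS.
by rewrite -h'E distrC (le_trans (val_unit_fun_dist _ _ _))// ltW.
Qed.

End delay_coincidences.

(** * Injective delay maps are embeddings *)

Section embeddings.

Lemma compact_injective_embedding {Y Z : topologicalType} (f : Y -> Z) :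
  compact [set: Y] -> hausdorff_space Z -> continuous f -> injective f ->
  embedding f.
Proof.
move=> cY hZ cf injf; split.
  by apply: continuous_comp_initial; exact: cf.
have /choice[g gP] : forall z : range f, exists y, f y = \val z.
  by move=> z; have [y _ yz] := set_valP z; exists y.
exists g; split=> [y|z|].
- by apply: injf; rewrite gP.
- by apply: val_inj => /=; rewrite gP.
apply/continuous_closedP => A cA.
have -> : g @^-1` A = \val @^-1` (f @` A).
  apply/seteqP; split=> z /=; first by move=> Agz; exists (g z).
  by move=> [y Ay yz]; rewrite (_ : g z = y)//; apply: injf; rewrite gP.
apply: closed_comp; first by move=> z _; exact: initial_continuous.
apply: compact_closed => //; apply: continuous_compact.
  exact: continuous_subspaceT.
exact: subclosed_compact cA cY _.
Qed.

Lemma hausdorff_separated_by {Z W : topologicalType} (I : Type) (g : I -> Z -> W) :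
  hausdorff_space W -> (forall i, continuous (g i)) ->
  (forall p q, (forall i, g i p = g i q) -> p = q) -> hausdorff_space Z.
Proof.
move=> hW cg gsep p q pq; apply: gsep => i; apply: hW => A B nA nB.
have [z [Az Bz]] := pq _ _ (cg i p A nA) (cg i q B nB).
by exists (g i z).
Qed.

Lemma delay_map_embedding {R : realType} {X : metricType R} (T : X -> X)
    (h : unit_fun R X) (m : nat) :
  compact [set: X] -> continuous T ->
  (forall x y, delay_eq T m h x y -> x = y) -> embedding (delay_map T h m).
Proof.
move=> cX cT inj; apply: compact_injective_embedding => //.
- apply: (@hausdorff_separated_by _ R _
    (fun (i : 'I_m.+1) (v : 'rV[unit_interval R]_m.+1) => \val (v ord0 i))).
  + exact: Rhausdorff.
  + move=> i v; apply: (@continuous_comp _ _ _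
      (fun v : 'rV[unit_interval R]_m.+1 => v ord0 i) \val).
      move=> A /= nA; exists (fun _ j => if j == i then A else setT).
        move=> i0 j; rewrite ord1; case: eqP => [->//|_]; exact: filterT.
      by move=> w /(_ ord0 i); rewrite eqxx.
    exact: initial_continuous.
  + move=> v w vw; apply/rowP => i; apply: val_inj; exact: vw.
- move=> x A [P nP PA]; apply: (@filterS _ _ _
    [set y | forall i j, P i j (delay_map T h m y i j)]) => [y /PA//|].
  apply: filter_forall => i; apply: filter_forall => j.
  have := nP i j; rewrite mxE => nPh.
  have : {for x, continuous (h \o iter j T)}.
    apply: continuous_comp; first exact: iter_continuous.
    exact: (@cts_fun _ _ h).
  move=> /(_ _ nPh) hx.
  apply: (@filterS _ (nbhs x) _ ((h \o iter j T) @^-1` P i j)) => // y.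
  by rewrite /= mxE.
- move=> x y /rowP xy; apply: inj => i im.
  by have := xy (Ordinal (im : (i < m.+1)%N)); rewrite !mxE.
Qed.

End embeddings.

(** * From local to global *)

Section local_to_global.
Context {R : realType} {X : metricType R} (compactX : compact [set: X]).
Variables (T : X -> X) (m : nat).

(** A pair has a neighbourhood depending on it, and uncountably many of these must be
    replaced by countably many sets. For each n there is a finite cover of X by sets of
    diameter less than 1 / (n + 1); the products of two members of these covers are
    countably many, and some such product containing the pair lies inside the given
    neighbourhood. Since h identifies (x, y) iff it identifies (y, x), either order of
    the pair may be used. *)
Lemma meagre_coincidences (I : countType) (S : I -> set (X * X))
    (A : set (unit_fun R X)) :
  (forall x y, x != y -> exists t x' y',
    [/\ (x', y') = (x, y) \/ (x', y') = (y, x), S t (x', y') &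
      exists2 r, 0 < r & nowhere_dense (coincide_on T m
        (S t `&` [set z | mdist x' z.1 < r /\ mdist y' z.2 < r]))]) ->
  A `<=` [set h | exists x y, x != y /\ delay_eq T m h x y] ->
  meagre A.
Proof.
move=> local AC.
have /choice[alpha alphaP] : forall n : nat, exists alpha : {fset set X},
    open_cover alpha /\ forall U, U \in alpha ->
      forall x y, U x -> U y -> mdist x y < n.+1%:R^-1.
  move=> n; apply: compact_open_cover => // x.
  exists (ball x (n.+1%:R^-1 / 2))°; split; first exact: open_interior.
    by apply: nbhsx_ballx; rewrite divr_gt0.
  move=> y z /interior_subset + /interior_subset; rewrite ballEmdist/= => xy xz.
  rewrite (le_lt_trans (metric_triangle _ x _))// [ltRHS]splitr ltrD//.
  by rewrite metric_sym.
pose U n i := nth set0 (enum_fset (alpha n)) i.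
pose B (k : I * (nat * (nat * nat))) :=
  coincide_on T m (S k.1 `&` (U k.2.1 k.2.2.1 `*` U k.2.1 k.2.2.2)).
apply: (@meagre_countable _ _ _
  (fun k => if pselect (nowhere_dense (B k)) then B k else set0)).
  by move=> k; case: pselect => [//|nB]; exact: nowhere_dense0.
move=> h /AC[x [y [xy hxy]]].
have [t [x' [y' [xyE St [r r0 nwd]]]]] := local x y xy.
have h'xy : delay_eq T m h x' y'.
  by case: xyE => E i im; rewrite (congr1 fst E : x' = _) (congr1 snd E : y' = _) hxy.
have [n nr] : exists n, n.+1%:R^-1 < r.
  exists (Num.truncn r^-1); rewrite invf_plt ?posrE//.
  by rewrite truncnS_gt ?invr_ge0 ?ltW.
have [[_ cov] small] := alphaP n.
have [V Va Vx] := cov x'; have [W Wa Wy] := cov y'.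
have UV : U n (index V (enum_fset (alpha n))) = V by rewrite /U nth_index.
have UW : U n (index W (enum_fset (alpha n))) = W by rewrite /U nth_index.
exists (t, (n, (index V (enum_fset (alpha n)), index W (enum_fset (alpha n))))) => //.
case: pselect => [nB|nB]; last first.
  case: nB; apply: nowhere_denseS nwd; apply: coincide_onS => -[u v] [/= Suv [Vu Wv]].
  split=> //; rewrite UV in Vu; rewrite UW in Wv.
  by split=> /=; apply: lt_trans nr; [exact: small Vx Vu|exact: small Wy Wv].
by exists (x', y') => //; split=> //; split; rewrite ?UV ?UW.
Qed.

End local_to_global.

Section local_geometry.
Context {R : realType} {X : metricType R}.

Lemma near_disjoint_images (f g : X -> X) x y : continuous f -> continuous g ->
  f x <> g y -> \forall r \near (0 : R)^'+, forall x' y',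
    mdist x x' <= r -> mdist y y' <= r -> f x' <> g y'.
Proof.
move=> cf cg fgxy.
have d0 : 0 < mdist (f x) (g y) / 2 by rewrite divr_gt0// mdist_gt0; exact/eqP.
have near_ball (k : X -> X) z : continuous k ->
    \forall r \near (0 : R)^'+, forall z', mdist z z' <= r ->
      mdist (k z) (k z') < mdist (f x) (g y) / 2.
  move=> ck; have /metricType_numDomainType.cvgrPdist_lt /(_ _ d0) := ck z.
  move=> /metricType_numDomainType.nbhs_mdistP[e /= e0 ke].
  near=> r => z' zz'; apply: ke => /=; apply: le_lt_trans zz' _.
  by near: r; exact: nbhs_right_lt.
near=> r => x' y' xx' yy' fg.
have fx : mdist (f x) (f x') < mdist (f x) (g y) / 2.
  by move: x' xx' {fg}; near: r; exact: near_ball.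
have gy : mdist (g y) (g y') < mdist (f x) (g y) / 2.
  by move: y' yy' {fg}; near: r; exact: near_ball.
have := metric_triangle (f x) (f x') (g y).
rewrite {2}fg [mdist (g y') _]metric_sym leNgt => /negP; apply.
by rewrite [ltRHS]splitr ltrD.
Unshelve. all: by end_near. Qed.

Lemma closed_mdist_le (x : X) (r : R) : closed [set y | mdist x y <= r].
Proof.
have -> : [set y | mdist x y <= r] =
    (fun y => inf [set mdist y z | z in [set x]]) @^-1` [set s | s <= r].
  by apply/seteqP; split=> y /=; rewrite image_set1 inf1 metric_sym.
apply: closed_comp; last exact: closed_le.
by move=> y _; apply: inf_mdist_continuous; exists x.
Qed.

Lemma closed_fixed_points (f : X -> X) : continuous f -> closed [set x | f x = x].
Proof.
move=> cf; rewrite -[X in closed X]setCK; apply: open_closedC.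
rewrite openE => x fx; have /(@near_disjoint_images f id) := fx.
move=> /(_ cf (fun _ => cvg_id)) H.
near (0 : R)^'+ => r; have r0 : 0 < r by near: r; exact: nbhs_right_gt.
apply/metricType_numDomainType.nbhs_mdistP; exists r => //= y /ltW xy.
by move: (xy) (xy); apply: (near H r).
Unshelve. all: by end_near. Qed.

End local_geometry.

Section subtypes.

Lemma compact_subtype {Y : topologicalType} (A : set Y) :
  compact A -> compact [set: A].
Proof.
move=> cA; apply/compact_near_coveringP => I F P FF cover.
have cA' := (near_covering_withinP A).2 ((compact_near_coveringP A).1 cA).
pose Q i x := forall a : A, \val a = x -> P i a.
have : \near F, A `<=` Q F.
  apply: (cA' I F Q FF) => x Ax.
  have [[V W] /= [nV FW] VW] := cover (SigSub (mem_set Ax)) Logic.I.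
  case: nV => _ /= [] [N oN <- /= Nx NV].
  exists (N, W); first by split=> //=; exact: open_nbhs_nbhs.
  by move=> [y i] /= [Ny Wi] Ay a ay; apply: (VW (a, i)); split=> //=;
    apply: NV; change (N (\val a)); rewrite ay.
apply: filterS => i AQ a _; apply: (AQ (\val a)) => //; exact: set_valP.
Qed.

End subtypes.

(** * Coincidences of delay vectors *)

Section dynamics.
Context {R : realType} {X : metricType R} (compactX : compact [set: X]).
Variables (T : X -> X) (injT : injective T) (contT : continuous T).

Let orb (i : nat) (x : X) : X := iter i T x.

Let cont_orb i : continuous (orb i). Proof. exact: iter_continuous. Qed.

Definition returns_from (q : nat) (x : X) : Prop :=
  forall p, (0 < p)%N -> iter p T x = x -> (q <= p)%N.

Lemma iter_injective i : injective (iter i T).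
Proof. by elim: i => [//|i IH] x y /= /injT /IH. Qed.

Lemma iter_eq_return (i j : nat) (x : X) : (i <= j)%N ->
  iter i T x = iter j T x -> iter (j - i) T x = x.
Proof.
move=> ij E; apply: (@iter_injective i).
by rewrite -iterD subnKC// E.
Qed.

Lemma returns_from_distinct (q : nat) (x : X) (i j : nat) : returns_from q x ->
  (i < q)%N -> (j < q)%N -> iter i T x = iter j T x -> i = j.
Proof.
move=> rq; wlog ij : i j / (i <= j)%N.
  by move=> H iq jq E; have [ij|/ltnW ji] := leqP i j; [|symmetry]; apply: H.
move=> iq jq /(iter_eq_return ij) E; apply/eqP; rewrite eqn_leq ij/=.
rewrite leqNgt; apply/negP => ltij.
by have := rq (j - i)%N; rewrite subn_gt0 => /(_ ltij E); lia.
Qed.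

Lemma near_jointly_injective (q : nat) (x : X) :
  (forall i j, (i < q)%N -> (j < q)%N -> iter i T x = iter j T x -> i = j) ->
  \forall r \near (0 : R)^'+,
    jointly_injective orb q [set x' | mdist x x' <= r].
Proof.
move=> dist.
have H : \forall r \near (0 : R)^'+, forall i j : 'I_q, i != j ->
    forall x' y', mdist x x' <= r -> mdist x y' <= r -> orb i x' <> orb j y'.
  apply: filter_forall => i; apply: filter_forall => j.
  have [->|ij] := eqVneq i j; first by near=> r.
  have Tij : orb i x <> orb j x.
    by move=> E; move/eqP: ij; apply; apply: val_inj; exact: dist E.
  by have := near_disjoint_images (@cont_orb i) (@cont_orb j) Tij; apply: filterS => r Hr _.
apply: filterS H => r Hr i j x' y' iq jq xx' yy' E.
have ij : i = j.
  have [//|ij] := eqVneq i j.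
  by case: (Hr (Ordinal iq) (Ordinal jq) _ x' y').
by split=> //; subst j; apply: iter_injective E.
Unshelve. all: by end_near. Qed.

Section layers.
Variable N : nat.

(** A point of period q <= N belongs to layer q, and every point belongs to
    layer N.+1, so that under the hypotheses of the theorem, with N = 2d, the bound
    dim (layer q) < q / 2 holds for all q from 1 to N.+1. *)
Definition layer (q : nat) : set X :=
  if (q <= N)%N then periodic_points T q else [set: X].

Lemma closed_periodic_points (q : nat) : closed (periodic_points T q).
Proof.
have -> : periodic_points T q =
    \bigcup_(p in [set p | (1 <= p <= q)%N]) [set x | iter p T x = x].
  by apply/seteqP; split=> x [p]; [move=> [pq px]; exists p|exists p].
apply: closed_bigcup => [|p _]; last exact/closed_fixed_points/iter_continuous.
apply: (@sub_finite_set _ _ `I_q.+1); last exact: finite_II.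
by move=> p /= /andP[].
Qed.

Lemma closed_layer q : closed (layer q).
Proof.
by rewrite /layer; case: ifP => _; [exact: closed_periodic_points|exact: closedT].
Qed.

Lemma layer_return (q : nat) (x : X) : (q <= N)%N -> layer q x ->
  returns_from q x -> iter q T x = x.
Proof.
rewrite /layer => -> [p [/andP[p0 pq] px]] /(_ p p0 px) qp.
by rewrite (_ : q = p)//; apply/eqP; rewrite eqn_leq qp.
Qed.

(** q is the period when this is at most N, and N.+1 otherwise. *)
Lemma exists_layer (x : X) :
  exists q, [/\ (0 < q <= N.+1)%N, layer q x & returns_from q x].
Proof.
pose P q := (0 < q)%N && ((q == N.+1) || `[< iter q T x = x >]).
have ex : exists q, P q by exists N.+1; rewrite /P eqxx.
case: (ex_minnP ex) => q /andP[q0 qP] qmin; exists q; split.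
- by rewrite q0 qmin// /P eqxx.
- rewrite /layer; case: leqP => // qN; exists q; rewrite q0 leqnn; split=> //.
  by case/orP: qP => [/eqP qE|/asboolP//]; rewrite qE ltnn in qN.
- by move=> p p0 px; apply: qmin; rewrite /P p0/=; apply/orP; right; apply/asboolP.
Qed.

Hypothesis fine_layer : forall q, (0 < q <= N.+1)%N ->
  fine_covers (layer q) (uphalf q).

(** Near y, all points of layer n with n <= N have exact period n, as a shorter
    period would contradict the disjointness of the first n images of the
    neighbourhood; hence the delay vectors are periodic there. *)
Lemma coincide_apart_nowhere_dense (q n : nat) (x y : X) :
  (0 < n)%N -> (n <= q)%N -> (q <= N.+1)%N ->
  returns_from q x -> returns_from n y ->
  (forall i j, (i < q)%N -> (j < n)%N -> iter i T x <> iter j T y) ->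
  exists2 r : R, 0 < r & nowhere_dense (coincide_on T N
    ((layer q `*` layer n) `&` [set z | mdist x z.1 < r /\ mdist y z.2 < r])).
Proof.
move=> n0 nq qN rx ry apart.
have H : \forall r \near (0 : R)^'+, forall (i : 'I_q) (j : 'I_n),
    forall x' y', mdist x x' <= r -> mdist y y' <= r -> orb i x' <> orb j y'.
  apply: filter_forall => i; apply: filter_forall => j.
  by apply: (near_disjoint_images (@cont_orb i) (@cont_orb j)); exact: apart.
near (0 : R)^'+ => r.
have r0 : 0 < r by near: r; exact: nbhs_right_gt.
have injx : jointly_injective orb q [set x' | mdist x x' <= r].
  near: r; apply: near_jointly_injective => i j; exact: returns_from_distinct.
have injy : jointly_injective orb n [set y' | mdist y y' <= r].
  near: r; apply: near_jointly_injective => i j; exact: returns_from_distinct.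
have Hr : forall (i : 'I_q) (j : 'I_n) x' y', mdist x x' <= r ->
    mdist y y' <= r -> orb i x' <> orb j y' by near: r; exact: H.
exists r => //.
pose K := layer q `&` [set x' | mdist x x' <= r].
pose L := layer n `&` [set y' | mdist y y' <= r].
have clK : closed K by apply: closedI; [exact: closed_layer|exact: closed_mdist_le].
have clL : closed L by apply: closedI; [exact: closed_layer|exact: closed_mdist_le].
apply: (@nowhere_denseS _ _ (coincide_on T N (K `*` L))).
  apply: coincide_onS => -[x' y'] [/= [Kx Ly] [xx' yy']].
  by split; split=> //=; exact: ltW.
apply: coincide_on_nowhere_dense => // [|h e ch e0].
  by apply: compact_setX; apply: subclosed_compact compactX _.
have [||||||||||||h' [ch' h'h sep]] := @separate_orbits R X compactX orb (@cont_orb)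
  q n K L h e => //.
- apply: (@fine_coversS _ _ _ _ (@subIsetl _ _ _)); apply: fine_layer; lia.
- apply: (@fine_coversS _ _ _ _ (@subIsetl _ _ _)); apply: fine_layer; lia.
- by move=> i j u v iq jq [_ Ku] [_ Kv]; exact: injx.
- by move=> i j u v iq jq [_ Ku] [_ Kv]; exact: injy.
- by move=> i j u v iq jq [_ Ku] [_ Lv]; exact: (Hr (Ordinal iq) (Ordinal jq)).
- move=> i v iq [lv Lv]; have [ineq|ni] := ltnP i n; first by rewrite modn_small.
  have vn : iter n T v = v.
    apply: layer_return => //; first lia.
    move=> p p0 pv; rewrite leqNgt; apply/negP => pn.
    by have [] := injy p 0%N v v pn n0 Lv Lv pv; lia.
  rewrite /orb {1}(divn_eq i n) addnC iterD.
  congr (iter _ T _); elim: (i %/ n)%N => [//|k IH].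
  by rewrite mulSn iterD IH.
exists h'; split=> // -[u v] [/= Ku Lv]; have [i iq ne] := sep u v Ku Lv.
by exists i; rewrite // -ltnS (leq_trans iq).
Unshelve. all: by end_near. Qed.

Lemma coincide_translate_nowhere_dense (q k : nat) (x : X) :
  (0 < q <= N.+1)%N -> (0 < k)%N -> (uphalf q <= N.+1)%N ->
  (forall i j, (i < uphalf q + k)%N -> (j < uphalf q + k)%N ->
    iter i T x = iter j T x -> i = j) ->
  exists2 r : R, 0 < r & nowhere_dense (coincide_on T N
    ([set z | layer q z.1 /\ z.2 = iter k T z.1] `&`
     [set z | mdist x z.1 < r /\ mdist (iter k T x) z.2 < r])).
Proof.
move=> qN k0 DN dist.
near (0 : R)^'+ => r.
have r0 : 0 < r by near: r; exact: nbhs_right_gt.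
have injx : jointly_injective orb (uphalf q + k) [set x' | mdist x x' <= r].
  by near: r; exact: near_jointly_injective.
exists r => //; pose K := layer q `&` [set x' | mdist x x' <= r].
have clK : closed K by apply: closedI; [exact: closed_layer|exact: closed_mdist_le].
apply: (@nowhere_denseS _ _
    (coincide_on T N ((fun x' => (x', iter k T x')) @` K))).
  apply: coincide_onS => -[x' y'] [/= [lx ->] [xx' _]].
  by exists x' => //; split=> //=; exact: ltW.
apply: coincide_on_nowhere_dense => // [|h e ch e0].
  apply: continuous_compact; last exact: subclosed_compact compactX _.
  apply: continuous_subspaceT => x'.
  by apply: cvg_pair; [exact: cvg_id|exact: iter_continuous].
have [||||h' [ch' h'h sep]] := @separate_translates R X compactX orb (@cont_orb)
  (uphalf q) k K h e k0 clK => //.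
- by apply: (@fine_coversS _ _ _ _ (@subIsetl _ _ _)); exact: fine_layer.
- by move=> i j u v iq jq [_ Ku] [_ Kv]; exact: injx.
exists h'; split=> // -[u v] [u' Ku [<- <-]]; have [i iq ne] := sep u' Ku.
by exists i; [rewrite -ltnS (leq_trans iq)|rewrite /= -iterD].
Unshelve. all: by end_near. Qed.

(** A coincidence T^i x = T^j x with i < j < uphalf q + k gives a period p = j - i.
    If p < k then y = T^k x equals T^(k - p) x; if k < p < 2k then x = T^(p - k) y; both
    contradict the minimality of k, and p = k would give y = x. So p >= 2k, and also
    p >= q, whereas p <= uphalf q + k - 1 < max (q, 2k). *)
Lemma minimal_translate_distinct (q k : nat) (x : X) : (0 < k)%N ->
  iter k T x <> x -> returns_from q x ->
  (forall l, (0 < l)%N -> iter k T x = iter l T x \/ x = iter l T (iter k T x) ->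
    (k <= l)%N) ->
  forall i j, (i < uphalf q + k)%N -> (j < uphalf q + k)%N ->
    iter i T x = iter j T x -> i = j.
Proof.
move=> k0 kx rq kmin i j; wlog ij : i j / (i <= j)%N.
  by move=> H iq jq E; have [ij|/ltnW ji] := leqP i j; [|symmetry]; apply: H.
move=> iq jq /(iter_eq_return ij); set p := (j - i)%N => px.
apply/eqP; rewrite eqn_leq ij/= leqNgt; apply/negP => ltij.
have p0 : (0 < p)%N by rewrite subn_gt0.
have qp := rq p p0 px.
have [pk|kp] := ltnP p k.
  have : (k <= k - p)%N.
    apply: kmin; [by rewrite subn_gt0|left].
    by rewrite -[in RHS]px -iterD subnK// ltnW.
  by lia.
have pk : p != k by apply/eqP => pk; apply: kx; rewrite -pk.
have : (k <= p - k)%N.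
  by apply: kmin; [lia|right; rewrite -iterD subnK].
by move: iq jq; rewrite /p in qp *; lia.
Qed.

(** For t = (true, (q, n)), pairs in layer q and layer n; for t = (false, (q, k)), the
    graph of T^k over layer q. Restricting to the graph, instead of a neighbourhood
    of it, keeps both points on one partition of unity. *)
Definition stratum (t : bool * (nat * nat)) : set (X * X) :=
  if t.1 then layer t.2.1 `*` layer t.2.2
  else [set z | layer t.2.1 z.1 /\ z.2 = iter t.2.2 T z.1].

Lemma pair_coincidence_nowhere_dense (x y : X) : x != y ->
  exists t x' y',
    [/\ (x', y') = (x, y) \/ (x', y') = (y, x), stratum t (x', y') &
      exists2 r : R, 0 < r & nowhere_dense (coincide_on T N
        (stratum t `&` [set z | mdist x' z.1 < r /\ mdist y' z.2 < r]))].
Proof.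
move=> xy.
have [[k0 Pk0]|/forallNP apart] := pselect (exists k, (0 < k)%N /\
    (y = iter k T x \/ x = iter k T y)).
  have ex : exists k, (0 < k)%N && `[< y = iter k T x \/ x = iter k T y >].
    by exists k0; have [-> ?] := Pk0; apply/asboolP.
  case: (ex_minnP ex) => k {k0 Pk0 ex} /andP[k0 /asboolP kP] kmin.
  wlog yE : x y xy kP kmin / y = iter k T x => [H|].
    have [yE|xE] := kP; first exact: H.
    have [||l|t [x' [y' [E St nd]]]] := H y x _ _ _ xE.
    - by rewrite eq_sym.
    - by left.
    - by move=> /andP[l0 /asboolP lP]; apply: kmin; rewrite l0; apply/asboolP;
        case: lP; [right|left].
    - by exists t, x', y'; split=> //; case: E; [right|left].
  have [q [qN lx rx]] := exists_layer x.
  exists (false, (q, k)), x, y; split; rewrite /stratum//=; first by left.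
  rewrite yE; apply: coincide_translate_nowhere_dense => //; first lia.
  apply: minimal_translate_distinct => //.
    by rewrite -yE => yx; rewrite yx eqxx in xy.
  by move=> l l0 lP; apply: kmin; rewrite l0 yE; apply/asboolP.
have apart' i j : iter i T x <> iter j T y.
  have [ij|/ltnW ji] := leqP i j => E.
    have xE : x = iter (j - i) T y.
      by apply: (@iter_injective i); rewrite -iterD subnKC.
    have [ij0|ij0] := posnP (j - i); first by move: xy; rewrite xE ij0/= eqxx.
    by apply: (apart (j - i)%N); split=> //; right.
  have yE : y = iter (i - j) T x.
    by apply: (@iter_injective j); rewrite -iterD subnKC.
  have [ij0|ij0] := posnP (i - j); first by move: xy; rewrite yE ij0/= eqxx.
  by apply: (apart (i - j)%N); split=> //; left.
have [q [qN lx rx]] := exists_layer x; have [n [nN ly ry]] := exists_layer y.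
have [nq|/ltnW qn] := leqP n q.
  exists (true, (q, n)), x, y; split; rewrite /stratum//=; first by left.
  by apply: coincide_apart_nowhere_dense => //; lia.
exists (true, (n, q)), y, x; split; rewrite /stratum//=; first by right.
apply: coincide_apart_nowhere_dense => //; try lia.
by move=> i j _ _ E; apply: (apart' j i).
Qed.

End layers.
End dynamics.

(** * The embedding theorem *)

Lemma fine_covers_subtype {R : realType} {X : topologicalType} (A : set X) (D : nat) :
  compact A -> (covering_dim R A < D%:R%:E)%E -> fine_covers A D.
Proof.
move=> cA dimA.
have -> : A = range (\val : A -> X).
  apply/seteqP; split=> [x Ax|_ [a _ <-]]; last exact: set_valP.
  by exists (SigSub (mem_set Ax)).
apply: (covering_dim_fine_covers _ _ _ dimA).
- exact: compact_subtype.
- exact: initial_continuous.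
- by move=> V [U oU <-]; exists U.
Qed.

Lemma fine_covers_layer {R : realType} {X : metricType R} (T : X -> X) (d q : nat) :
  compact [set: X] -> continuous T ->
  covering_dim R X = d%:R%:E ->
  (forall n : nat, (1 <= n <= 2 * d)%N ->
    (covering_dim R (periodic_points T n) < (n%:R / 2)%:E)%E) ->
  (0 < q <= (2 * d).+1)%N -> fine_covers (layer T (2 * d) q) (uphalf q).
Proof.
move=> cX cT dimX dimP /andP[q0 qd]; rewrite /layer; case: leqP => qd'.
  apply: (@fine_covers_subtype R).
    by apply: subclosed_compact cX _ => //; exact: closed_periodic_points.
  apply: lt_le_trans (dimP q _) _; first by rewrite q0.
  rewrite lee_fin ler_pdivrMr// -natrM ler_nat; lia.
rewrite -[X in fine_covers X _](image_id [set: X]).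
apply: (@covering_dim_fine_covers R X X idfun) => //.
- by move=> x; exact: cvg_id.
- by move=> V oV; exists V.
- by rewrite dimX lte_fin ltr_nat; lia.
Qed.

Theorem theorem1p1 (R : realType) (X : metricType R) (T : X -> X) (d : nat)
    (compactX : compact [set: X])
    (injT : injective T) (contT : continuous T)
    (dimX : covering_dim R X = d%:R%:E)
    (dimP : forall n : nat, (1 <= n <= 2 * d)%N ->
      (covering_dim R (periodic_points T n) < (n%:R / 2)%:E)%E) :
  comeagre [set h : unit_fun R X | embedding (delay_map T h (2 * d))].
Proof.
apply: (meagre_coincidences compactX (T := T) (m := (2 * d)%N)).
  apply: pair_coincidence_nowhere_dense => // q.
  exact: fine_covers_layer.
move=> h /= notemb; apply: contrapT => inj; apply: notemb.
apply: delay_map_embedding => // x y xy; apply: contrapT => /eqP nxy.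
by apply: inj; exists x, y.
Qed.
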